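(* Let $\mathcal{HC}$ be a finite, recursion-free set of Horn clauses over a constraint language $\mathcal{C}$ that has the interpolation property. Then the following are equivalent: (1) $\mathcal{HC}$ is semantically solvable; (2) $\mathcal{HC}$ is syntactically solvable; (3) the expansion $\mathit{exp}(\mathcal{HC})$ is unsatisfiable.
   Context: A first-order vocabulary is fixed: interpreted function symbols $\mathcal{F}$, interpreted predicate symbols $\mathcal{P}$ (including $=$), with interpretation given by a class $\mathcal{S}$ of structures $(U,I)$. A constraint language $\mathcal{C}$ is a set of first-order formulae over $\mathcal{F},\mathcal{P}$ and a countably infinite variable set $\mathcal{X}$; satisfiability and entailment $\models$ are relative to $\mathcal{S}$. $\mathcal{C}$ has the interpolation property if for all $A,B\in\mathcal{C}$ with $A\wedge B$ unsatisfiable there is $I\in\mathcal{C}$ with $A\models I$, $B\models\neg I$, and the free variables of $I$ among those common to $A$ and $B$. Fix a set $\mathcal{R}$ of uninterpreted fixed-arity relation symbols disjoint from $\mathcal{F},\mathcal{P}$. A Horn clause is a formula $C\wedge B_1\wedge\cdots\wedge B_n\to H$ where $C\in\mathcal{C}$, each $B_i$ is an application $p(t_1,\ldots,t_k)$ of some $p\in\mathcal{R}$ to terms over $\mathcal{F},\mathcal{X}$, and $H$ is either such an application or $\mathit{false}$; its variables are implicitly universally quantified. A relation symbol assignment $\mathit{sol}$ maps each $n$-ary $p\in\mathcal{R}$ to a constraint $\mathit{sol}(p)=C_p[x_1,\ldots,x_n]$; $\mathit{sol}(h)$ is the clause $h$ with each $p(\bar t)$ replaced by $C_p[\bar t]$.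 $\mathcal{HC}$ is semantically solvable if for every structure $(U,I)\in\mathcal{S}$ there is an interpretation of the symbols of $\mathcal{R}$ as relations over $U$ making the universal closure of every clause of $\mathcal{HC}$ true; it is syntactically solvable if there is a relation symbol assignment $\mathit{sol}$ such that the universal closure of $\mathit{sol}(h)$ holds in every structure of $\mathcal{S}$ for every $h\in\mathcal{HC}$. $\mathcal{HC}$ induces the dependence relation $p\to q$ iff some clause has $p$ in its head and $q$ in its body; $\mathcal{HC}$ is recursion-free if this relation is acyclic. Expansion (for finite recursion-free $\mathcal{HC}$): writing $C'\wedge B_1'\wedge\cdots\wedge B_n'\to H'$ for a fresh variant of a clause (all its variables renamed to fresh variables, anew at each use), $\mathit{exp}(\mathcal{HC}) = \bigvee_{(C\wedge B_1\wedge\cdots\wedge B_n\to\mathit{false})\in\mathcal{HC}} C'\wedge \mathit{exp}'(B_1')\wedge\cdots\wedge\mathit{exp}'(B_n')$ and $\mathit{exp}'(p(\bar t)) = \bigvee_{(C\wedge B_1\wedge\cdots\wedge B_n\to p(\bar s))\in\mathcal{HC}} C'\wedge\mathit{exp}'(B_1')\wedge\cdots\wedge\mathit{exp}'(B_n')\wedge \bar t=\bar s'$.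
   Formalization: The constraint language is additionally assumed to contain true, false and all equations between terms, and to be closed under conjunction, disjunction and injective renaming of free variables; for an arbitrary set of formulae with interpolation the claim is false. *)

(* Defs.v *)
From Stdlib Require List Relation_Operators.
From mathcomp Require Import all_boot.

Set Implicit Arguments.
Unset Strict Implicit.
Unset Printing Implicit Defensive.

Record symbols := Symbols { sym :> Type; arity : sym -> nat }.
Arguments arity {s} _.

Section FirstOrder.

Variables F P : symbols.

(* Free variables are indexed by nat.  Formulae are taken up to renaming of
   bound variables: under a quantifier, index 0 is the bound variable and the
   index x.+1 stands for the variable x outside.  Equality, which every
   structure interprets as identity, is a constructor and not a member of P. *)
Inductive term : Type :=
| Var of nat
| Fun (f : F) of ('I_(arity f) -> term).

Inductive formula : Type :=
| Top
| Bot
| Eq of term & term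
| Pred (p : P) of ('I_(arity p) -> term)
| Not of formula
| And of formula & formula
| Or of formula & formula
| Imp of formula & formula
| All of formula
| Ex of formula.

Definition bigAnd : seq formula -> formula := foldr And Top.
Definition bigOr : seq formula -> formula := foldr Or Bot.

Fixpoint term_fv (t : term) (x : nat) : Prop :=
  match t with
  | Var y => x = y
  | Fun _ ts => exists i, term_fv (ts i) x
  end.

Fixpoint fv (A : formula) (x : nat) : Prop :=
  match A with
  | Top | Bot => False
  | Eq t s => term_fv t x \/ term_fv s x
  | Pred _ ts => exists i, term_fv (ts i) x
  | Not A => fv A x
  | And A B | Or A B | Imp A B => fv A x \/ fv B x
  | All A | Ex A => fv A x.+1
  end.

Fixpoint term_subst (s : nat -> term) (t : term) : term :=
  match t with
  | Var x => s x
  | Fun f ts => Fun (fun i => term_subst s (ts i))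
  end.

(* The substitution to use below a quantifier; it avoids capture. *)
Definition up (s : nat -> term) (x : nat) : term :=
  if x is y.+1 then term_subst (fun z => Var z.+1) (s y) else Var 0.

Fixpoint subst (s : nat -> term) (A : formula) : formula :=
  match A with
  | Top => Top
  | Bot => Bot
  | Eq t u => Eq (term_subst s t) (term_subst s u)
  | Pred _ ts => Pred (fun i => term_subst s (ts i))
  | Not A => Not (subst s A)
  | And A B => And (subst s A) (subst s B)
  | Or A B => Or (subst s A) (subst s B)
  | Imp A B => Imp (subst s A) (subst s B)
  | All A => All (subst (up s) A)
  | Ex A => Ex (subst (up s) A)
  end.

Definition term_rename (r : nat -> nat) : term -> term :=
  term_subst (fun x => Var (r x)).
Definition rename (r : nat -> nat) : formula -> formula :=
  subst (fun x => Var (r x)).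

Record structure := Structure {
  dom : Type;
  dom_inhabited : inhabited dom;
  fun_interp : forall f : F, ('I_(arity f) -> dom) -> dom;
  pred_interp : forall p : P, ('I_(arity p) -> dom) -> Prop }.

Fixpoint eval (M : structure) (v : nat -> dom M) (t : term) : dom M :=
  match t with
  | Var x => v x
  | Fun f ts => fun_interp (fun i => eval v (ts i))
  end.

Definition scons (U : Type) (d : U) (v : nat -> U) (x : nat) : U :=
  if x is y.+1 then v y else d.

Fixpoint holds (M : structure) (v : nat -> dom M) (A : formula) : Prop :=
  match A with
  | Top => True
  | Bot => False
  | Eq t s => eval v t = eval v s
  | Pred _ ts => pred_interp (fun i => eval v (ts i))
  | Not A => ~ holds v A
  | And A B => holds v A /\ holds v B
  | Or A B => holds v A \/ holds v B
  | Imp A B => holds v A -> holds v B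
  | All A => forall d, holds (scons d v) A
  | Ex A => exists d, holds (scons d v) A
  end.

(* Truth of the universal closure of A in M. *)
Definition closure_holds (M : structure) (A : formula) : Prop :=
  forall v : nat -> dom M, holds v A.

Section Constraints.

Variable S : structure -> Prop.

Definition satisfiable (A : formula) : Prop :=
  exists M, S M /\ exists v : nat -> dom M, holds v A.

Definition unsatisfiable (A : formula) : Prop := ~ satisfiable A.

Definition entails (A B : formula) : Prop :=
  forall M, S M -> forall v : nat -> dom M, holds v A -> holds v B.

(* Closure under the operations from which expansions are built, so that the
   expansion of clauses over C is again in C.  For an arbitrary set C of
   formulae having the interpolation property, semantic solvability does not
   imply syntactic solvability: take C = {r(x) /\ y = y, ~ r(x) /\ y = y} with
   the clauses r(x) /\ y = y -> p(x) and (~ r(x) /\ y = y) /\ p(x) -> false;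
   C has no member whose only free variable is x. *)
Record constraint_language (C : formula -> Prop) : Prop := {
  lang_top : C Top;
  lang_bot : C Bot;
  lang_eq : forall t s, C (Eq t s);
  lang_and : forall A B, C A -> C B -> C (And A B);
  lang_or : forall A B, C A -> C B -> C (Or A B);
  lang_rename : forall r, injective r -> forall A, C A -> C (rename r A) }.

Definition interpolation_property (C : formula -> Prop) : Prop :=
  forall A B, C A -> C B -> unsatisfiable (And A B) ->
  exists I, [/\ C I, entails A I, entails B (Not I)
              & forall x, fv I x -> fv A x /\ fv B x].

End Constraints.

Section Horn.

Variables (R : eqType) (ar : R -> nat).

Record atom := Atom { rel : R; args : 'I_(ar rel) -> term }.

(* The head None stands for false. *)
Record clause := Clause {
  constr : formula;
  body : seq atom;
  head : option atom }.

Definition head_rel (h : clause) : option R := omap rel (head h).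

Definition clauses_over (C : formula -> Prop) (HC : seq clause) : Prop :=
  forall h, List.In h HC -> C (constr h).

Definition rel_interp (U : Type) : Type := forall p : R, ('I_(ar p) -> U) -> Prop.

Definition atom_holds (M : structure) (rho : rel_interp (dom M))
    (v : nat -> dom M) (B : atom) : Prop :=
  rho (rel B) (fun i => eval v (args i)).

Definition clause_holds (M : structure) (rho : rel_interp (dom M)) (h : clause)
    : Prop :=
  forall v : nat -> dom M,
    holds v (constr h) ->
    (forall B, List.In B (body h) -> atom_holds rho v B) ->
    if head h is Some H then atom_holds rho v H else False.

Definition semantically_solvable (S : structure -> Prop) (HC : seq clause)
    : Prop :=
  forall M, S M -> exists rho : rel_interp (dom M),
    forall h, List.In h HC -> clause_holds rho h.

(* The formal parameters x_1, ..., x_n of the constraint assigned to an n-ary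
   symbol are the variables 0, ..., n - 1. *)
Definition assignment (C : formula -> Prop) (sol : R -> formula) : Prop :=
  forall p, C (sol p) /\ forall x, fv (sol p) x -> x < ar p.

Definition sol_atom (sol : R -> formula) (B : atom) : formula :=
  subst (fun x => nth (Var x) (codom (@args B)) x) (sol (rel B)).

Definition sol_clause (sol : R -> formula) (h : clause) : formula :=
  Imp (And (constr h) (bigAnd [seq sol_atom sol B | B <- body h]))
      (if head h is Some H then sol_atom sol H else Bot).

Definition syntactically_solvable (S : structure -> Prop) (C : formula -> Prop)
    (HC : seq clause) : Prop :=
  exists sol, assignment C sol /\
    forall h, List.In h HC -> forall M, S M -> closure_holds M (sol_clause sol h).

Definition depends (HC : seq clause) (p q : R) : Prop :=
  exists h, [/\ List.In h HC, head_rel h = Some p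
              & exists B, List.In B (body h) /\ rel B = q].

Definition recursion_free (HC : seq clause) : Prop :=
  forall p, ~ Relation_Operators.clos_trans R (depends HC) p p.

Definition atom_rename (r : nat -> nat) (B : atom) : atom :=
  @Atom (rel B) (fun i => term_rename r (args i)).

Definition variant (r : nat -> nat) (h : clause) : clause :=
  Clause (rename r (constr h)) [seq atom_rename r B | B <- body h]
         (omap (atom_rename r) (head h)).

(* Each use of a clause in the expansion is identified by its position, the
   list of clause and body-atom indices leading to it (innermost first); as
   pickle is injective, variants at different positions share no variables. *)
Definition fresh (pi : seq nat) (x : nat) : nat := pickle (pi, x).

Definition numbered (T : Type) (s : seq T) : seq (nat * T) :=
  zip (iota 0 (size s)) s.

Definition head_terms (h : clause) : seq term :=
  if head h is Some H then codom (@args H) else [::].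

Definition eqs (ts ss : seq term) : formula :=
  bigAnd [seq Eq ts_ss.1 ts_ss.2 | ts_ss <- zip ts ss].

Definition exp_body (e : seq nat -> atom -> formula) (pi : seq nat)
    (h : clause) : formula :=
  And (constr h) (bigAnd [seq e (jB.1 :: pi) jB.2 | jB <- numbered (body h)]).

(* exp_step e pi a is the right-hand side of the equation for exp'(a) at the
   position pi, with e in place of exp'. *)
Definition exp_step (HC : seq clause) (e : seq nat -> atom -> formula)
    (pi : seq nat) (a : atom) : formula :=
  bigOr [seq let h := variant (fresh (ih.1 :: pi)) ih.2 in
             And (exp_body e (ih.1 :: pi) h) (eqs (codom (@args a)) (head_terms h))
        | ih <- numbered HC & head_rel ih.2 == Some (rel a)].

(* The recursion depth n is only there to make the definition structural:
   see exp_atomE. *)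
Fixpoint exp_atom_rec (HC : seq clause) (n : nat) (pi : seq nat) (a : atom)
    : formula :=
  if n is m.+1 then exp_step HC (exp_atom_rec HC m) pi a else Bot.

Definition exp_atom (HC : seq clause) : seq nat -> atom -> formula :=
  exp_atom_rec HC (size HC).

Definition expansion (HC : seq clause) : formula :=
  bigOr [seq exp_body (exp_atom HC) [:: ih.1] (variant (fresh [:: ih.1]) ih.2)
        | ih <- numbered HC & head_rel ih.2 == None].

Lemma eq_map_In (T T' : Type) (f g : T -> T') (s : seq T) :
  (forall x, List.In x s -> f x = g x) -> map f s = map g s.
Proof.
elim: s => //= x s IH H; rewrite H; last by left.
by rewrite IH // => y Hy; apply: H; right.
Qed.

Lemma In_zip2 (T T' : Type) (s : seq T) (t : seq T') x :
  List.In x (zip s t) -> List.In x.2 t.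
Proof.
by elim: s t => [|a s IH] [|b t] //= [<-|H]; [left | right; apply: IH].
Qed.

Lemma In_filter (T : Type) (a : pred T) (s : seq T) x :
  List.In x (filter a s) -> a x /\ List.In x s.
Proof.
elim: s => //= y s IH; case Ea: (a y) => /=.
  by case=> [<-|/IH[]]; split=> //; [left | right].
by move=> /IH[]; split=> //; right.
Qed.

Lemma In_map (T T' : Type) (f : T -> T') (s : seq T) y :
  List.In y (map f s) -> exists x, List.In x s /\ f x = y.
Proof.
elim: s => //= x s IH [<-|/IH[z [Hz Ez]]]; first by exists x; split=> //; left.
by exists z; split=> //; right.
Qed.

Fixpoint bounded (HC : seq clause) (n : nat) (p : R) : Prop :=
  if n is m.+1 then forall q, depends HC p q -> bounded HC m q
  else forall h, List.In h HC -> head_rel h <> Some p.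

Lemma exp_step_ext HC e e' pi a :
  (forall pi' b, depends HC (rel a) (rel b) -> e pi' b = e' pi' b) ->
  exp_step HC e pi a = exp_step HC e' pi a.
Proof.
move=> He; congr bigOr; apply: eq_map_In => -[i h] ih.
have [/= /eqP hp /In_zip2 /= hHC] := In_filter ih; congr And; congr And; congr bigAnd.
apply: eq_map_In => -[j B] /In_zip2 jB.
have [B' [B'h /= <-]] := In_map jB.
by apply: He; exists h; split=> //; exists B'.
Qed.

Lemma exp_step_nohead HC e pi a :
  bounded HC 0 (rel a) -> exp_step HC e pi a = Bot.
Proof.
move=> H; rewrite /exp_step.
case E: [seq ih <- _ | _] => [|ih s] //=.
have ih_in : List.In ih [seq ih <- numbered HC | head_rel ih.2 == Some (rel a)].
  by rewrite E; left.
have [/eqP h1 /In_zip2 h2] := In_filter ih_in.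
by case: (H _ h2 h1).
Qed.

Lemma exp_atom_recS HC n pi a : bounded HC n (rel a) ->
  exp_atom_rec HC n.+1 pi a = exp_atom_rec HC n pi a.
Proof.
elim: n pi a => [|n IH] pi a Hb; first exact: exp_step_nohead.
by apply: exp_step_ext => pi' b /Hb; apply: IH.
Qed.

Lemma recursion_free_bounded HC p : recursion_free HC -> bounded HC (size HC) p.
Proof.
move=> rf; set hs := pmap head_rel HC.
have hsP q h : List.In h HC -> head_rel h = Some q -> q \in hs.
  rewrite {}/hs; elim: HC {rf} => //= h' s IH [->|hs] Hq; first by rewrite Hq /= mem_head.
  case: (head_rel h') => [r|] /=; rewrite ?inE; last exact: IH.
  by rewrite IH ?orbT.
pose reach := Relation_Operators.clos_trans R (depends HC).
have grow q s : uniq s -> {subset s <= hs} -> (forall x, x \in s -> reach x q) ->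
    q \in hs -> uniq (q :: s) /\ {subset q :: s <= hs}.
  move=> us ss rs qhs; split=> [|x]; last by rewrite inE => /orP[/eqP->|/ss].
  by rewrite /= us andbT; apply/negP => /rs /rf.
suff gen n q s : uniq s -> {subset s <= hs} -> (forall x, x \in s -> reach x q) ->
    size HC <= n + size s -> bounded HC n q.
  by apply: (gen _ _ [::]) => //; rewrite addn0.
elim: n q s => [|n IH] q s us ss rs le /=.
  move=> h hHC hq; have [uqs sqs] := grow q s us ss rs (hsP _ _ hHC hq).
  have := uniq_leq_size uqs sqs; rewrite /= size_pmap => lt.
  by have := leq_trans lt (leq_trans (count_size _ _) le); rewrite ltnn.
move=> r dqr; have [h [hHC hq _]] := dqr.
have [uqs sqs] := grow q s us ss rs (hsP _ _ hHC hq).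
apply: (IH r (q :: s)) => //; last by rewrite /= addnS -addSn.
move=> x; rewrite inE => /orP[/eqP->|/rs xq]; first exact: Relation_Operators.t_step.
by apply: Relation_Operators.t_trans xq _; apply: Relation_Operators.t_step.
Qed.

(* The defining equation of exp'. *)
Lemma exp_atomE HC pi a : recursion_free HC ->
  exp_atom HC pi a = exp_step HC (exp_atom HC) pi a.
Proof.
by move=> rf; rewrite -[RHS]/(exp_atom_rec HC _.+1 _ _) exp_atom_recS //;
  exact: recursion_free_bounded.
Qed.

End Horn.

End FirstOrder.

Arguments Top {F P}.
Arguments Bot {F P}.

(* Main.v *)
Require Import Defs.
From Stdlib Require Import FunctionalExtensionality.
From mathcomp Require Import all_boot.
(* [all_boot] shadows [Defs.head]. *)
Import Defs.

Set Implicit Arguments.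
Unset Strict Implicit.
Unset Printing Implicit Defensive.

(* Semantic solvability gives syntactic solvability by resolution.  A goal
   B /\ a_1 /\ ... /\ a_n -> false that is true in a model of the clauses with an
   atomic head is resolved on a_1 with every clause for its symbol p; recursion
   freedom makes this terminate.  Assignments solving the clauses with an atomic
   head are closed under pointwise conjunction, so one of them, sol, refutes all
   resolvents at once.  Then the disjunction over the clauses for p of their
   instantiated bodies and B /\ sol(a_2) /\ ... /\ sol(a_n) have an interpolant in
   the arguments of p, and conjoining it to sol(p) refutes the goal itself.
   Without the conjunction, several occurrences of p in one goal could not be
   treated one at a time.

   Any model of the clauses refutes the expansion.  Conversely, if the expansion
   is unsatisfiable, then derivability is a model: as different positions have
   different variables, the valuations used in a derivation of false can be glued
   to a single valuation satisfying the expansion. *)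

(** * Substitution and coincidence *)

Section Semantics.

Variables (F P : symbols) (M : structure F P).
Implicit Types (A B : formula F P) (v w : nat -> dom M) (t : term F).

Lemma eval_subst v s t :
  eval v (term_subst s t) = eval (fun x => eval v (s x)) t.
Proof.
elim: t => //= f ts IH; congr fun_interp.
by apply: functional_extensionality => i; rewrite IH.
Qed.

Lemma eval_rename v r t : eval v (term_rename r t) = eval (v \o r) t.
Proof. exact: eval_subst. Qed.

Lemma map_eval_rename v r (ts : seq (term F)) :
  map (eval v) (map (term_rename r) ts) = map (eval (v \o r)) ts.
Proof. by rewrite -map_comp; apply: eq_map => t; apply: eval_rename. Qed.

Lemma holds_subst v s A :
  holds v (subst s A) <-> holds (fun x => eval v (s x)) A.
Proof.
have evalup w r d :
    (fun x => eval (scons d w) (up r x)) = scons d (fun x => eval w (r x)).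
  by apply: functional_extensionality => -[|x] //=; rewrite eval_subst.
have args_eq n w r (ts : 'I_n -> term F) : (fun i => eval w (term_subst r (ts i)))
    = (fun i => eval (fun x => eval w (r x)) (ts i)).
  by apply: functional_extensionality => i; rewrite eval_subst.
elim: A v s => //=.
- by move=> t u v s; rewrite !eval_subst.
- by move=> p ts v s; rewrite args_eq.
- by move=> A IH v s; have := IH v s; tauto.
- by move=> A IHA B IHB v s; have := IHA v s; have := IHB v s; tauto.
- by move=> A IHA B IHB v s; have := IHA v s; have := IHB v s; tauto.
- by move=> A IHA B IHB v s; have := IHA v s; have := IHB v s; tauto.
- move=> A IH v s; split=> H d; first by rewrite -evalup; apply/IH.
  by apply/IH; rewrite evalup.
- move=> A IH v s; split=> -[d H]; exists d; first by rewrite -evalup; apply/IH.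
  by apply/IH; rewrite evalup.
Qed.

Lemma holds_rename v r A : holds v (rename r A) <-> holds (v \o r) A.
Proof. exact: holds_subst. Qed.

Lemma eval_fv v w t : (forall x, term_fv t x -> v x = w x) -> eval v t = eval w t.
Proof.
elim: t => [x|f ts IH] /= H; first exact: H.
congr fun_interp; apply: functional_extensionality => i.
by apply: IH => x Hx; apply: H; exists i.
Qed.

Lemma holds_fv v w A :
  (forall x, fv A x -> v x = w x) -> holds v A -> holds w A.
Proof.
(* Negation and implication reverse the direction, so the induction needs the equivalence. *)
suff: (forall x, fv A x -> v x = w x) -> (holds v A <-> holds w A).
  by move=> H /H[].
have sconsfv B d v' w' : (forall x, fv B x.+1 -> v' x = w' x) ->
    forall x, fv B x -> scons d v' x = scons d w' x.
  by move=> H [|x] //=; apply: H.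
elim: A v w => //=.
- by move=> t u v w H; rewrite (@eval_fv v w t) ?(@eval_fv v w u) //;
    move=> x Hx; apply: H; tauto.
- move=> p ts v w H.
  rewrite (_ : (fun i => eval v (ts i)) = (fun i => eval w (ts i))) //.
  apply: functional_extensionality => i.
  by apply: eval_fv => x Hx; apply: H; exists i.
- by move=> A IH v w /IH; tauto.
- by move=> A IHA B IHB v w H; rewrite (IHA v w) ?(IHB v w) // => x Hx;
    apply: H; tauto.
- by move=> A IHA B IHB v w H; rewrite (IHA v w) ?(IHB v w) // => x Hx;
    apply: H; tauto.
- by move=> A IHA B IHB v w H; rewrite (IHA v w) ?(IHB v w) // => x Hx;
    apply: H; tauto.
- move=> A IH v w H; split=> K d; have := K d; apply IH; last exact: sconsfv.
  by move=> x Hx; rewrite (sconsfv A d v w).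
- move=> A IH v w H; split=> -[d K]; exists d; move: K; apply IH; last exact: sconsfv.
  by move=> x Hx; rewrite (sconsfv A d v w).
Qed.

Lemma holds_bigAnd (T : Type) v (f : T -> formula F P) (s : seq T) :
  holds v (bigAnd [seq f x | x <- s]) <-> forall x, List.In x s -> holds v (f x).
Proof.
elim: s => //= x s IH; split=> [[Hx /IH Hs] y [<-|] //|H]; first exact: Hs.
by split; [apply: H; left | apply/IH => y Hy; apply: H; right].
Qed.

Lemma holds_bigOr (T : Type) v (f : T -> formula F P) (s : seq T) :
  holds v (bigOr [seq f x | x <- s]) <-> exists2 x, List.In x s & holds v (f x).
Proof.
elim: s => [|x s IH] /=; first by split=> // -[].
split=> [[Hx|/IH[y ys Hy]]|[y [<-|ys] Hy]].
- by exists x => //; left.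
- by exists y => //; right.
- by left.
- by right; apply/IH; exists y.
Qed.

Lemma holds_eqs v (ts ss : seq (term F)) : size ts = size ss ->
  holds v (eqs P ts ss) <-> map (eval v) ts = map (eval v) ss.
Proof.
rewrite /eqs; elim: ts ss => [|t ts IH] [|s ss] //= [/IH {}IH].
by split=> [[-> /IH ->]|[-> /IH]].
Qed.

End Semantics.

(** * Free variables under substitution *)

Section FreeVariables.

Variables F P : symbols.

Lemma term_fv_subst s (t : term F) x :
  term_fv (term_subst s t) x -> exists2 y, term_fv t y & term_fv (s y) x.
Proof.
elim: t => [y|f ts IH] /=; first by exists y.
by move=> [i /IH[y Hy Hs]]; exists y => //; exists i.
Qed.

Lemma fv_subst s (A : formula F P) x :
  fv (subst s A) x -> exists2 y, fv A y & term_fv (s y) x.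
Proof.
have upfv (B : formula F P) (r : nat -> term F) z :
    (exists2 y, fv B y & term_fv (up r y) z.+1) ->
    exists2 y, fv B y.+1 & term_fv (r y) z.
  move=> [[|y] //= By Hy]; exists y => //.
  by have [z' Hz' /= [->]] := term_fv_subst Hy.
elim: A s x => //=.
- by move=> t u s x [] /term_fv_subst[y Hy Hx]; exists y => //; [left | right].
- by move=> p ts s x [i /term_fv_subst[y Hy Hx]]; exists y => //; exists i.
- by move=> A IHA B IHB s x [/IHA|/IHB] [y Hy Hx]; exists y => //; [left | right].
- by move=> A IHA B IHB s x [/IHA|/IHB] [y Hy Hx]; exists y => //; [left | right].
- by move=> A IHA B IHB s x [/IHA|/IHB] [y Hy Hx]; exists y => //; [left | right].
- by move=> A IH s x /IH/upfv.
- by move=> A IH s x /IH/upfv.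
Qed.

Lemma fv_rename r (A : formula F P) x :
  fv (rename r A) x -> exists2 y, fv A y & x = r y.
Proof. exact: fv_subst. Qed.

End FreeVariables.

(** * Definability in the constraint language *)

(** Codes a pair of valuations as one, without a bound on the variables of either. *)
Definition mix (U : Type) (v u : nat -> U) (x : nat) : U :=
  if odd x then u x./2 else v x./2.

Lemma mix_even (U : Type) (v u : nat -> U) : mix v u \o double = v.
Proof.
by apply: functional_extensionality => x; rewrite /mix /= odd_double doubleK.
Qed.

Lemma mix_odd (U : Type) (v u : nat -> U) : mix v u \o (succn \o double) = u.
Proof.
by apply: functional_extensionality => x; rewrite /mix /= odd_double uphalf_double.
Qed.

Lemma mix_split (U : Type) (w : nat -> U) :
  mix (w \o double) (w \o (succn \o double)) = w.
Proof.
apply: functional_extensionality => x; rewrite /mix /=.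
by case: ifP => ox; rewrite -[in RHS](odd_double_half x) ox.
Qed.

Lemma odd_inj : injective (succn \o double).
Proof. by move=> x y /= [/double_inj]. Qed.

Definition odd_rename (f : nat -> nat) x := if odd x then (f x./2).*2.+1 else x.

Lemma odd_rename_inj f : injective f -> injective (odd_rename f).
Proof.
move=> f_inj x y E; have Eo : odd x = odd y.
  have oddE z : odd (odd_rename f z) = odd z.
    by rewrite /odd_rename; case: ifP => //= _; rewrite odd_double.
  by rewrite -oddE E oddE.
move: E; rewrite /odd_rename -Eo; case: ifP => // ox [/double_inj/f_inj E].
by rewrite -[x]odd_double_half -[y]odd_double_half E Eo.
Qed.

Lemma mix_rename (U : Type) f (v u : nat -> U) :
  mix v u \o odd_rename f = mix v (u \o f).
Proof.
apply: functional_extensionality => x; rewrite /mix /odd_rename /=.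
by case ox: (odd x); rewrite /= ?ox ?odd_double //= uphalf_double.
Qed.

Section Definability.

Variables (F P : symbols) (S : structure F P -> Prop) (C : formula F P -> Prop).
Hypothesis C_lang : constraint_language C.

(* [C] need not be closed under quantification, so sets of valuations are
   described by members of [C] with additional, implicitly existential, odd
   variables. *)
Definition definable (K : forall M : structure F P, (nat -> dom M) -> Prop) : Prop :=
  exists2 A, C A & forall M v, K M v <-> exists u, holds (mix v u) A.

Lemma lang_eqs ts ss : C (eqs P ts ss).
Proof.
rewrite /eqs; elim: (zip ts ss) => [|x s IH] /=; first exact: lang_top.
by apply: lang_and => //; apply: lang_eq.
Qed.

Lemma definable_ext K K' : (forall M v, K M v <-> K' M v) ->
  definable K -> definable K'.
Proof.
by move=> E [A CA HA]; exists A => // M v; rewrite -E HA.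
Qed.

Lemma definable_formula A : C A -> definable (fun M v => holds v A).
Proof.
move=> CA; exists (rename double A).
  by apply: lang_rename => //; apply: double_inj.
move=> M v; split=> [H|[u /holds_rename]]; last by rewrite mix_even.
by exists v; apply/holds_rename; rewrite mix_even.
Qed.

(** The two formulae may need different witnesses: those of [A] move to the even places of [u],
    those of [A'] to the odd places. *)
Lemma definable_and K K' : definable K -> definable K' ->
  definable (fun M v => K M v /\ K' M v).
Proof.
move=> [A CA HA] [A' CA' HA']; have even_inj := double_inj.
exists (And (rename (odd_rename double) A) (rename (odd_rename (succn \o double)) A')).
  by apply: lang_and => //; apply: lang_rename => //; apply: odd_rename_inj => //;
    apply: odd_inj.
move=> M v; split=> [[/HA[u Hu] /HA'[u' Hu']]|[u [/holds_rename H /holds_rename H']]].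
  by exists (mix u u'); split; apply/holds_rename;
    rewrite mix_rename ?mix_even ?mix_odd.
by rewrite !mix_rename in H H'; split; [apply/HA | apply/HA'];
  [exists (u \o double) | exists (u \o (succn \o double))].
Qed.

Lemma definable_or K K' : definable K -> definable K' ->
  definable (fun M v => K M v \/ K' M v).
Proof.
move=> [A CA HA] [A' CA' HA']; exists (Or A A'); first exact: lang_or.
move=> M v; split=> [[/HA|/HA']|] [u Hu]; try by exists u; [left | right].
  by exists u; left.
  by exists u; right.
by case: Hu => Hu; [left; apply/HA | right; apply/HA']; exists u.
Qed.

Lemma definable_exists_in (T : Type) (s : seq T)
    (K : T -> forall M : structure F P, (nat -> dom M) -> Prop) :
  (forall x, List.In x s -> definable (K x)) ->
  definable (fun M v => exists2 x, List.In x s & K x M v).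
Proof.
elim: s => [|x s IH] HK.
  apply: (@definable_ext (fun M v => holds v Bot)) => [M v|].
    by split=> // -[].
  by apply: definable_formula; apply: lang_bot.
apply: (@definable_ext (fun M v => K x M v \/ exists2 y, List.In y s & K y M v)).
  move=> M v; split=> [[Kx|[y ys Ky]]|[y [<-|ys] Ky]].
  - by exists x => //; left.
  - by exists y => //; right.
  - by left.
  - by right; exists y.
apply: definable_or; first by apply: HK; left.
by apply: IH => y ys; apply: HK; right.
Qed.

Lemma definable_forall_in (T : Type) (s : seq T)
    (K : T -> forall M : structure F P, (nat -> dom M) -> Prop) :
  (forall x, List.In x s -> definable (K x)) ->
  definable (fun M v => forall x, List.In x s -> K x M v).
Proof.
elim: s => [|x s IH] HK.
  apply: (@definable_ext (fun M v => holds v Top)) => [M v|].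
    by split=> // _ ? [].
  by apply: definable_formula; apply: lang_top.
apply: (@definable_ext (fun M v => K x M v /\ forall y, List.In y s -> K y M v)).
  move=> M v; split=> [[Kx Ks] y [<-|/Ks] //|Ks]; split; first by apply: Ks; left.
  by move=> y ys; apply: Ks; right.
apply: definable_and; first by apply: HK; left.
by apply: IH => y ys; apply: HK; right.
Qed.

(** The whole valuation [mix w u] becomes the odd part of a new one, which puts a variable [x] of
    [ss] at $4x + 1$. *)
Lemma definable_image K (ts ss : seq (term F)) : size ts = size ss ->
  definable K ->
  definable (fun M v => exists2 w, K M w & map (eval v) ts = map (eval w) ss).
Proof.
move=> sz [A CA HA].
exists (And (rename (succn \o double) A)
  (eqs P [seq term_rename double t | t <- ts]
         [seq term_rename (succn \o double \o double) s | s <- ss])).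
  by apply: lang_and => //; [apply: lang_rename => //; apply: odd_inj | apply: lang_eqs].
have evalE M (v u : nat -> dom M) :
    ([seq eval (mix v u) t | t <- [seq term_rename double t | t <- ts]] = map (eval v) ts)
  * ([seq eval (mix v u) s | s <- [seq term_rename (succn \o double \o double) s | s <- ss]]
      = map (eval (u \o double)) ss).
  by rewrite !map_eval_rename compA mix_even mix_odd.
move=> M v; split=> [[w /HA[u Hu] E]|[u [/holds_rename Hu]]].
  exists (mix w u); split; first by apply/holds_rename; rewrite mix_odd.
  by apply/holds_eqs; rewrite ?size_map // !evalE mix_even.
rewrite mix_odd in Hu; move/holds_eqs; rewrite !size_map !evalE => /(_ sz) E.
by exists (u \o double) => //; apply/HA; exists (u \o (succn \o double)); rewrite mix_split.
Qed.

(* Renames the variables of [mix v u] apart according to [b], except for the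
   first [n] variables of [v]. *)
Definition split_rename n (b : bool) z :=
  if ~~ odd z && (z./2 < n) then z./2 else n + (b + z.*2).

Lemma split_rename_inj n b : injective (split_rename n b).
Proof.
move=> x y; rewrite /split_rename.
case: ifPn => [/andP[ox nx]|_]; case: ifPn => [/andP[oy ny]|_] E.
- by rewrite -[x]odd_double_half -[y]odd_double_half E (negPf ox) (negPf oy).
- by rewrite E ltnNge leq_addr in nx.
- by rewrite -E ltnNge leq_addr in ny.
- by move/addnI/addnI/double_inj: E.
Qed.

Lemma split_rename_even n b x : x < n -> split_rename n b x.*2 = x.
Proof. by move=> ltx; rewrite /split_rename odd_double doubleK ltx. Qed.

(** Outside the shared variables the images under the two renamings differ in parity after
    subtracting [n]. *)
Lemma split_rename_common n y y' :
  split_rename n false y = split_rename n true y' -> split_rename n false y < n.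
Proof.
rewrite /split_rename; case: ifPn => [/andP[] //|_].
case: ifPn => [/andP[_ ny'] -> //|_] /addnI /(congr1 odd).
by rewrite /= !odd_double.
Qed.

Lemma split_rename_witness n b (U : Type) (v u : nat -> U) :
  exists2 w, w \o split_rename n b = mix v u & forall x, x < n -> w x = v x.
Proof.
(* Subtracting [n] and halving undoes the renaming outside the shared variables, for either [b]. *)
exists (fun x => if x < n then v x else mix v u (x - n)./2) => [|x -> //].
apply: functional_extensionality => z /=; rewrite /split_rename.
case: (boolP (~~ odd z && (z./2 < n))) => [/andP[oz nz]|_].
  by rewrite nz /mix (negPf oz).
by rewrite ltnNge leq_addr addKn half_bit_double.
Qed.

Lemma mkseqP (U : Type) n (v w : nat -> U) :
  mkseq v n = mkseq w n <-> forall x, x < n -> v x = w x.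
Proof.
split=> [/eq_in_map E x ltx|E]; first by apply: E; rewrite mem_iota.
by apply/eq_in_map => x; rewrite mem_iota => /E.
Qed.

(** The defining formulae, renamed so as to share at most the first [n] variables, are jointly
    unsatisfiable, and the free variables of an interpolant lie below [n]. A valuation that agrees
    with [v] there and carries the witnesses therefore transfers its truth value to [v]. *)
Lemma definable_interpolant (C_interp : interpolation_property S C) n K K' :
  definable K -> definable K' ->
  (forall M, S M -> forall v v', K M v -> K' M v' -> mkseq v n <> mkseq v' n) ->
  exists I, [/\ C I, forall x, fv I x -> x < n
    & forall M, S M -> forall v, (K M v -> holds v I) /\ (K' M v -> ~ holds v I)].
Proof.
move=> [A CA HA] [A' CA' HA'] disj.
pose B b (D : formula F P) := rename (split_rename n b) D.
have CB b D : C D -> C (B b D).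
  by move=> CD; apply: lang_rename => //; apply: split_rename_inj.
have split_val M (v : nat -> dom M) b D : holds v (B b D) ->
    exists u, holds (mix (v \o split_rename n b \o double) u) D.
  move/holds_rename => H; exists (v \o split_rename n b \o (succn \o double)).
  by rewrite mix_split.
have [I [CI AI A'I fvI]] : exists I, [/\ C I, entails S (B false A) I,
    entails S (B true A') (Not I)
    & forall x, fv I x -> fv (B false A) x /\ fv (B true A') x].
  apply: C_interp; [exact: CB | exact: CB | move=> [M [SM [v /= []]]]].
  move=> /split_val/HA HK /split_val/HA' HK'; case: (disj M SM _ _ HK HK').
  by apply/mkseqP => x ltx /=; rewrite !split_rename_even.
have fvn x : fv I x -> x < n.
  move=> /fvI[/fv_rename[y _ ->] /fv_rename[y' _]]; exact: split_rename_common.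
exists I; split=> // M SM v; split.
- move=> /HA[u Hu]; have [w wE wv] := split_rename_witness n false v u.
  apply: holds_fv (AI M SM w _) => [x /fvn/wv //|].
  by apply/holds_rename; rewrite wE.
- move=> /HA'[u Hu]; have [w wE wv] := split_rename_witness n true v u.
  have HI : ~ holds w I by apply: A'I => //; apply/holds_rename; rewrite wE.
  by apply: contra_not HI; apply: holds_fv => x /fvn/wv.
Qed.

End Definability.

(** * Resolution *)

Lemma In_filter_iff (T : Type) (a : pred T) (s : seq T) x :
  List.In x (filter a s) <-> a x /\ List.In x s.
Proof.
split; first exact: In_filter.
elim: s => [|y s IH] /= [ax] // [->|xs]; first by rewrite ax; left.
by case: (a y); [right|]; apply: IH.
Qed.

Lemma In_map_iff (T T' : Type) (f : T -> T') (s : seq T) y :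
  List.In y (map f s) <-> exists x, List.In x s /\ f x = y.
Proof.
split=> [|[x [xs <-]]]; first exact: In_map.
by elim: s xs => //= z s IH [->|/IH]; [left | right].
Qed.

Lemma In_cat (T : Type) (s t : seq T) x :
  List.In x (s ++ t) <-> List.In x s \/ List.In x t.
Proof.
elim: s => [|y s IH] /=; first by split; [right | case].
by rewrite IH; tauto.
Qed.

(** * Atoms, goals and resolvents *)

Section Atoms.

Variables (F P : symbols) (R : eqType) (ar : R -> nat).
Implicit Types (a b : atom F ar) (h : clause F P ar).

(** A sequence, so that the argument values of atoms with different symbols have one type. *)
Definition vals (M : structure F P) (v : nat -> dom M) a : seq (dom M) :=
  map (eval v) (codom (@args _ _ _ a)).

Lemma vals_rename (M : structure F P) (v : nat -> dom M) r a :
  vals v (atom_rename r a) = vals (v \o r) a.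
Proof.
rewrite /vals !codomE -!map_comp.
by apply: eq_map => i /=; rewrite eval_rename.
Qed.

Lemma atom_holds_vals (M : structure F P) (rho : rel_interp ar (dom M)) v w a b :
  rel a = rel b -> vals v a = vals w b -> atom_holds rho v a -> atom_holds rho w b.
Proof.
case: a b => [p ts] [q ss] /= E; move: ss; case: _ / E => ss.
rewrite /vals /atom_holds /= !codomE -!map_comp => /eq_in_map E.
congr rho; apply: functional_extensionality => i.
by apply: E; rewrite -enumT mem_enum.
Qed.

Lemma head_relP h p : head_rel h = Some p ->
  exists2 H, head h = Some H & rel H = p.
Proof. by rewrite /head_rel; case: (head h) => //= H [<-]; exists H. Qed.

Lemma size_head_terms h p : head_rel h = Some p -> size (head_terms h) = ar p.
Proof.
by move=> /head_relP[H hH <-]; rewrite /head_terms hH size_codom card_ord.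
Qed.

Definition body_holds (M : structure F P) (rho : rel_interp ar (dom M))
    (v : nat -> dom M) (B : formula F P) (l : seq (atom F ar)) : Prop :=
  holds v B /\ forall b, List.In b l -> atom_holds rho v b.

Lemma clause_holds_head (M : structure F P) (rho : rel_interp ar (dom M)) v w h a :
  clause_holds rho h -> head_rel h = Some (rel a) ->
  body_holds rho w (constr h) (body h) ->
  vals v a = map (eval w) (head_terms h) -> atom_holds rho v a.
Proof.
move=> hh /head_relP[H hH Ha] [Hc Hb]; rewrite /head_terms hH => E.
by have := hh w Hc Hb; rewrite hH; apply: atom_holds_vals.
Qed.

(** Even variables belong to the goal, odd ones to the clause; equations take the place of
    unification. *)
Definition resolvent_constr (B : formula F P) a h : formula F P :=
  And (And (rename double B) (rename (succn \o double) (constr h)))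
      (eqs P (map (term_rename double) (codom (@args _ _ _ a)))
             (map (term_rename (succn \o double)) (head_terms h))).

Definition resolvent_body (l : seq (atom F ar)) h : seq (atom F ar) :=
  map (atom_rename (succn \o double)) (body h) ++ map (atom_rename double) l.

Lemma atom_holds_rename (M : structure F P) (rho : rel_interp ar (dom M)) v r b :
  atom_holds rho v (atom_rename r b) <-> atom_holds rho (v \o r) b.
Proof.
by split; apply: atom_holds_vals; rewrite ?vals_rename.
Qed.

Lemma body_holds_resolvent (M : structure F P) (rho : rel_interp ar (dom M)) v B a l h :
  head_rel h = Some (rel a) ->
  body_holds rho v (resolvent_constr B a h) (resolvent_body l h) <->
  [/\ body_holds rho (v \o double) B l,
      body_holds rho (v \o (succn \o double)) (constr h) (body h)
    & vals (v \o double) a = map (eval (v \o (succn \o double))) (head_terms h)].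
Proof.
move=> hp.
have eqsE : holds v (eqs P (map (term_rename double) (codom (@args _ _ _ a)))
               (map (term_rename (succn \o double)) (head_terms h))) <->
    vals (v \o double) a = map (eval (v \o (succn \o double))) (head_terms h).
  rewrite holds_eqs; last first.
    by rewrite size_map size_codom card_ord size_map (size_head_terms hp).
  by rewrite !map_eval_rename.
rewrite /body_holds /resolvent_body /= !holds_rename eqsE.
split=> [[[[HB Hh] E] Hl]|[[HB Hl] [Hh Hb] E]].
  split=> //; split=> // b bl; apply/atom_holds_rename; apply: Hl.
    by apply/In_cat; right; apply/In_map_iff; exists b.
  by apply/In_cat; left; apply/In_map_iff; exists b.
split=> // x /In_cat[xb|xl].
  by have [b [bb <-]] := In_map xb; apply/atom_holds_rename; apply: Hb.
by have [b [bl <-]] := In_map xl; apply/atom_holds_rename; apply: Hl.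
Qed.

End Atoms.

(** * Assignments as interpretations *)

Section Solutions.

Variables (F P : symbols) (S : structure F P -> Prop) (C : formula F P -> Prop).
Variables (R : eqType) (ar : R -> nat) (HC : seq (clause F P ar)).
Hypothesis C_lang : constraint_language C.
Implicit Types (sol : R -> formula F P) (h : clause F P ar).

(** Quantifying over [w] avoids a default value for the variables from [ar p] on; for an assignment
    the choice of [w] is immaterial, by [sol_rel_holds]. *)
Definition sol_rel sol (M : structure F P) : rel_interp ar (dom M) :=
  fun p d => exists2 w : nat -> dom M, (forall i : 'I_(ar p), w i = d i) & holds w (sol p).

Lemma mkseq_codom (U : Type) n (w : nat -> U) (d : 'I_n -> U) :
  mkseq w n = codom d <-> forall i : 'I_n, w i = d i.
Proof.
rewrite /mkseq -val_enum_ord -map_comp codomE.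
by split=> [/eq_in_map E i|E]; [apply: E; rewrite mem_enum | apply: eq_map].
Qed.

Lemma sol_rel_atom sol M v (a : atom F ar) :
  atom_holds (@sol_rel sol M) v a <->
  exists2 w, holds w (sol (rel a)) & vals v a = mkseq w (ar (rel a)).
Proof.
have E w : vals v a = mkseq w (ar (rel a)) <->
    forall i : 'I_(ar (rel a)), w i = eval v (args i).
  rewrite -(mkseq_codom w (fun i => eval v (args i))).
  by rewrite /vals !codomE -map_comp; split=> ->.
by split=> [[w /E Hw Hs]|[w Hs /E Hw]]; exists w.
Qed.

Lemma sol_rel_holds sol M (w : nat -> dom M) p (d : 'I_(ar p) -> dom M) :
  assignment ar C sol ->
  (forall i : 'I_(ar p), w i = d i) -> sol_rel sol d -> holds w (sol p).
Proof.
move=> /(_ p)[_ fvp] wd [w' w'd]; apply: holds_fv => x /fvp ltx.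
by rewrite -[x]/(val (Ordinal ltx)) w'd wd.
Qed.

Lemma sol_atomE sol M (v : nat -> dom M) (a : atom F ar) : assignment ar C sol ->
  holds v (sol_atom sol a) <-> atom_holds (@sol_rel sol M) v a.
Proof.
move=> sol_ok; rewrite /sol_atom holds_subst.
set w := fun x => _; have wd (i : 'I_(ar (rel a))) : w i = eval v (args i).
  by rewrite /w codomE (nth_map i) ?size_enum_ord ?nth_ord_enum.
by split=> [Hw|]; [exists w | apply: sol_rel_holds sol_ok wd].
Qed.

Definition solves sol h := forall M, S M -> clause_holds (@sol_rel sol M) h.

(** Replaces substitution into clauses by truth under [sol_rel], the form used from here on. *)
Lemma sol_clauseE sol h : assignment ar C sol ->
  (forall M, S M -> closure_holds M (sol_clause sol h)) <-> solves sol h.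
Proof.
move=> sol_ok; have headE M (v : nat -> dom M) :
    holds v (if head h is Some H then sol_atom sol H else Bot) <->
    (if head h is Some H then atom_holds (@sol_rel sol M) v H else False).
  by case: (head h) => // H; apply: sol_atomE.
split=> Hh M SM v.
  move=> Hc Hb; apply/headE; apply: Hh => //; split=> //.
  by apply/holds_bigAnd => B HB; apply/sol_atomE => //; apply: Hb.
move=> [Hc /holds_bigAnd Hb]; apply/headE; apply: Hh => // B HB.
by apply/sol_atomE => //; apply: Hb.
Qed.

Lemma syntactically_solvableE : syntactically_solvable S C HC <->
  exists2 sol, assignment ar C sol & forall h, List.In h HC -> solves sol h.
Proof.
split=> [[sol [sol_ok Hs]]|[sol sol_ok Hs]]; exists sol => //.
  by move=> h /Hs Hh; apply/sol_clauseE.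
by split=> // h /Hs Hh; apply/sol_clauseE.
Qed.

(** * Solutions of the clauses with atomic head *)

Definition definite_solution sol :=
  assignment ar C sol /\ forall h, List.In h HC -> head h -> solves sol h.

Definition refutes sol B l :=
  forall M, S M -> forall v, ~ body_holds (@sol_rel sol M) v B l.

Lemma body_holds_mono (M : structure F P) (rho rho' : rel_interp ar (dom M)) v B l :
  (forall p d, rho p d -> rho' p d) -> body_holds rho v B l -> body_holds rho' v B l.
Proof. by move=> le [HB Hl]; split=> // b /Hl; apply: le. Qed.

Lemma refutes_mono sol sol' B l :
  (forall M p d, @sol_rel sol M p d -> @sol_rel sol' M p d) ->
  refutes sol' B l -> refutes sol B l.
Proof. by move=> le H M SM v /(body_holds_mono (le M)); apply: H. Qed.

Definition sol_meet sol sol' p := And (sol p) (sol' p).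

Lemma sol_meet_l sol sol' M p d :
  @sol_rel (sol_meet sol sol') M p d -> @sol_rel sol M p d.
Proof. by case=> w wd [H _]; exists w. Qed.

Lemma sol_meet_r sol sol' M p d :
  @sol_rel (sol_meet sol sol') M p d -> @sol_rel sol' M p d.
Proof. by case=> w wd [_ H]; exists w. Qed.

(** The two witnesses may differ beyond the arity, but [sol' p] has no free variables there, so the
    witness for [sol] serves both. *)
Lemma sol_rel_meet sol sol' M p d : assignment ar C sol' ->
  @sol_rel sol M p d -> @sol_rel sol' M p d -> @sol_rel (sol_meet sol sol') M p d.
Proof.
move=> ok' [w wd Hw] Hw'; exists w => //; split=> //.
exact: sol_rel_holds ok' wd Hw'.
Qed.

Lemma assignment_meet sol sol' :
  assignment ar C sol -> assignment ar C sol' -> assignment ar C (sol_meet sol sol').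
Proof.
move=> ok ok' p; have [Cp fp] := ok p; have [Cp' fp'] := ok' p.
by split; [apply: lang_and | move=> x [/fp|/fp']].
Qed.

(** A body true under the conjunction is true under both assignments, so both give the head, which
    is a single atom. *)
Lemma definite_solution_meet sol sol' :
  definite_solution sol -> definite_solution sol' ->
  definite_solution (sol_meet sol sol').
Proof.
move=> [ok Hs] [ok' Hs']; split=> [|h hHC hh M SM v Hc Hb].
  exact: assignment_meet.
have := Hs h hHC hh M SM v Hc; have := Hs' h hHC hh M SM v Hc.
case: (head h) hh => // H _ H1 H2; apply: sol_rel_meet => //.
  by apply: H2 => b /Hb; apply: sol_meet_l.
by apply: H1 => b /Hb; apply: sol_meet_r.
Qed.

Lemma assignment_top : assignment ar C (fun _ => Top).
Proof. by move=> p; split=> //; apply: lang_top. Qed.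

Lemma definite_solution_top : definite_solution (fun _ => Top).
Proof.
split=> [|h _ hh M SM v _ _]; first exact: assignment_top.
case: (head h) hh => // H _; apply/sol_atomE => //; exact: assignment_top.
Qed.

(** The conjunction of the individual solutions works, as a stronger assignment makes fewer bodies
    true. *)
Lemma definite_solution_refutes (T : Type) (s : seq T) B l :
  (forall x, List.In x s -> exists2 sol, definite_solution sol & refutes sol (B x) (l x)) ->
  exists2 sol, definite_solution sol & forall x, List.In x s -> refutes sol (B x) (l x).
Proof.
elim: s => [|x s IH] Hs; first by exists (fun _ => Top) => //; apply: definite_solution_top.
have [|sol def_sol sol_s] := IH; first by move=> y ys; apply: Hs; right.
have [|sol' def_sol' sol_x] := Hs x; first by left.
exists (sol_meet sol sol'); first exact: definite_solution_meet.
move=> y [<-|/sol_s]; last by apply: refutes_mono => M p d; apply: sol_meet_l.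
by apply: refutes_mono sol_x => M p d; apply: sol_meet_r.
Qed.

(** * Interpolation for one resolution step *)

Lemma map_eval_Var (M : structure F P) (w : nat -> dom M) n :
  map (eval w) (mkseq (@Var F) n) = mkseq w n.
Proof. by rewrite -map_comp. Qed.

Lemma definable_body sol B l : assignment ar C sol -> C B ->
  definable C (fun M v => body_holds (@sol_rel sol M) v B l).
Proof.
move=> sol_ok CB; apply: definable_and => //; first exact: definable_formula.
apply: definable_forall_in => // b _.
apply: (definable_ext (K := fun M v => exists2 w, holds w (sol (rel b)) &
    map (eval v) (codom (@args _ _ _ b)) = map (eval w) (mkseq (@Var F) (ar (rel b))))).
  by move=> M v; rewrite sol_rel_atom; split=> -[w Hw E]; exists w => //;
    move: E; rewrite map_eval_Var.
apply: definable_image => //; first by rewrite size_mkseq size_codom card_ord.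
by apply: definable_formula => //; case: (sol_ok (rel b)).
Qed.

Lemma resolution_step sol B a l : interpolation_property S C -> clauses_over C HC ->
  C B -> definite_solution sol ->
  (forall h, List.In h HC -> head_rel h = Some (rel a) ->
     refutes sol (resolvent_constr B a h) (resolvent_body l h)) ->
  exists2 sol', definite_solution sol' & refutes sol' B (a :: l).
Proof.
move=> C_interp HC_C CB def_sol; have [sol_ok sol_def] := def_sol => sol_res.
set p := rel a in sol_res *; set n := ar p.
(* Tuples are read off the first [n] variables. [K] has those that the clauses for [p] yield in one
   step from [sol]; [K'] has the values of the arguments of [a] where the rest of the goal holds. *)
pose K M (v : nat -> dom M) :=
  exists2 h, List.In h [seq h <- HC | head_rel h == Some p] &
  exists2 w, body_holds (@sol_rel sol M) w (constr h) (body h) &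
    map (eval v) (mkseq (@Var F) n) = map (eval w) (head_terms h).
pose K' M (v : nat -> dom M) :=
  exists2 w, body_holds (@sol_rel sol M) w B l &
    map (eval v) (mkseq (@Var F) n) = map (eval w) (codom (@args _ _ _ a)).
have defK : definable C K.
  apply: definable_exists_in => // h /In_filter_iff[/eqP hp hHC].
  apply: definable_image => //; first by rewrite size_mkseq (size_head_terms hp).
  by apply: definable_body => //; apply: HC_C.
have defK' : definable C K'.
  apply: definable_image => //; first by rewrite size_mkseq size_codom card_ord.
  exact: definable_body.
have disj M : S M -> forall v v' : nat -> dom M, K M v -> K' M v' ->
    mkseq v n <> mkseq v' n.
  move=> SM v v' [h /In_filter_iff[/eqP hp hHC] [w Hw]]; rewrite map_eval_Var => ->.
  move=> [w' Hw']; rewrite map_eval_Var => -> E.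
  (* A common tuple makes a resolvent true, with the goal valuation on the even and the clause
     valuation on the odd variables. *)
  apply: (sol_res h hHC hp M SM (mix w' w)); apply/body_holds_resolvent => //.
  by rewrite mix_even mix_odd.
have [I [CI fvI HI]] := definable_interpolant C_lang C_interp defK defK' disj.
(* Only the constraint of [p] is strengthened. *)
pose solI q := if q == p then I else Top.
have ok_solI : assignment ar C solI.
  move=> q; rewrite /solI; case: eqP => [->|_] //; exact: assignment_top.
exists (sol_meet sol solI).
  split=> [|h hHC hh M SM v Hc Hb]; first exact: assignment_meet.
  have Hb' := body_holds_mono (@sol_meet_l sol solI M) (conj Hc Hb).
  have := sol_def h hHC hh M SM v Hc (proj2 Hb').
  case hH: (head h) hh => [H|] // _ H1; apply: sol_rel_meet => //.
  case: (eqVneq (rel H) p) => [Hp|/negPf Hp]; last first.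
    by apply/sol_atomE => //; rewrite /sol_atom /solI Hp.
  (* As the body holds under [sol], the argument values of the head form a tuple in [K], where [I]
     holds. *)
  have [w HwI wH] : exists2 w, holds w I & vals v H = mkseq w n.
    move/sol_rel_atom: (H1) => [w _ wH]; rewrite Hp -/n in wH; exists w => //.
    apply: (proj1 (HI M SM w)); exists h.
      by apply/In_filter_iff; rewrite /head_rel hH /= Hp.
    by exists v => //; rewrite map_eval_Var -wH /head_terms hH.
  by apply/sol_rel_atom; exists w; rewrite /solI ?Hp ?eqxx.
move=> M SM v [HB Hl].
(* [I] holds at the arguments of [a], but the rest of the goal, true under [sol] as well, puts them
   in [K']. *)
have /sol_rel_atom[w [_]] := Hl a (or_introl erefl).
rewrite /solI eqxx => HwI wa; apply: (proj2 (HI M SM w)) HwI.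
exists v; last by rewrite map_eval_Var -wa.
by split=> // b Hb; apply: sol_meet_l (Hl b (or_intror Hb)).
Qed.

(** * Termination of resolution *)

Definition sound_goal B l :=
  forall M, S M -> exists2 rho : rel_interp ar (dom M),
    forall h, List.In h HC -> head h -> clause_holds rho h
  & forall v, ~ body_holds rho v B l.

(** Resolution changes the constraint and the arguments of a goal, so the induction runs on the list
    of its symbols alone. *)
Definition refutable (ps : seq R) :=
  forall B l, C B -> map (@rel _ _ _) l = ps -> sound_goal B l ->
  exists2 sol, definite_solution sol & refutes sol B l.

Hypothesis C_interp : interpolation_property S C.
Hypothesis HC_over_C : clauses_over C HC.

Lemma refutable_nil : refutable [::].
Proof.
move=> B [|//] CB _ sound; exists (fun _ => Top); first exact: definite_solution_top.
by move=> M SM v [HB _]; have [rho _ /(_ v)] := sound M SM; apply; split.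
Qed.

(** Resolvents with clauses for [p] stay true in the model given for the goal, so each has a
    refuting solution; a common one feeds [resolution_step]. *)
Lemma refutable_cons p ps :
  (forall h, List.In h HC -> head_rel h = Some p ->
     refutable (map (@rel _ _ _) (body h) ++ ps)) ->
  refutable (p :: ps).
Proof.
move=> Hp B [//|a l] CB [ap lps] sound; rewrite -{}ap in Hp.
have [|sol def_sol sol_res] := @definite_solution_refutes _
    [seq h <- HC | head_rel h == Some (rel a)]
    (resolvent_constr B a) (resolvent_body l).
  move=> h /In_filter_iff[/eqP hp hHC]; apply: (Hp h hHC hp).
  - apply: lang_and => //; last exact: lang_eqs.
    apply: lang_and => //; apply: lang_rename => //.
    + exact: double_inj.
    + exact: odd_inj.
    + exact: HC_over_C.
  - by rewrite /resolvent_body map_cat -!map_comp -lps.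
  move=> M SM; have [rho rhoH rhoB] := sound M SM; exists rho => // v.
  move=> /(body_holds_resolvent rho v B l hp)[[HB Hl] Hh E].
  apply: (rhoB (v \o double)); split=> // b [<-|/Hl //].
  apply: (clause_holds_head _ hp Hh E); apply: rhoH => //.
  by have [H ->] := head_relP hp.
apply: (resolution_step (sol := sol)) => // h hHC hp.
by apply: sol_res; apply/In_filter_iff; rewrite hp.
Qed.

(** Resolving replaces a symbol of bound [n.+1] by body symbols of bound [n], whence an outer
    induction on [n] and an inner one on [ps]; [qs] is the part of the goal that waits behind. *)
Lemma refutable_bounded n ps qs :
  (forall p, p \in ps -> bounded HC n p) -> refutable qs -> refutable (ps ++ qs).
Proof.
elim: n ps qs => [|n IHn]; elim=> [|p ps IH] qs //= Hps Hqs; apply: refutable_cons.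
  by move=> h hHC hp; case: (Hps p (mem_head p ps) h hHC hp).
move=> h hHC hp; apply: IHn; last first.
  by apply: IH => // q qps; apply: Hps; rewrite inE qps orbT.
move=> q qh; apply: (Hps p); first exact: mem_head.
exists h; split=> //; elim: (body h) qh => //= b l IHl.
rewrite inE => /orP[/eqP->|/IHl[b' [b'l <-]]]; first by exists b; split=> //; left.
by exists b'; split=> //; right.
Qed.

(** The goals are the clauses with head [false]; a solution of the other clauses that refutes all
    goals solves every clause. *)
Lemma semantically_syntactically_solvable :
  recursion_free HC -> semantically_solvable S HC -> syntactically_solvable S C HC.
Proof.
move=> HC_rf sem; apply/syntactically_solvableE.
have [|sol [ok sol_def] sol_goals] := @definite_solution_refutes _
    [seq h <- HC | ~~ head h] (@constr _ _ _ _) (@body _ _ _ _).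
  move=> h /In_filter_iff[hh hHC].
  have ref : refutable (map (@rel _ _ _) (body h)).
    rewrite -[map _ _]cats0; apply: refutable_bounded refutable_nil => p _.
    exact: recursion_free_bounded.
  apply: ref => //; first exact: HC_over_C.
  move=> M SM; have [rho rhoH] := sem M SM; exists rho => [h' /rhoH //|v [Hc Hb]].
  by have := rhoH h hHC v Hc Hb; case: (head h) hh.
exists sol => // h hHC; case hh: (isSome (head h)); first exact: sol_def.
move=> M SM v Hc Hb; case: (sol_goals h _ M SM v) => //.
by apply/In_filter_iff; rewrite hh.
Qed.

Lemma syntactically_semantically_solvable :
  syntactically_solvable S C HC -> semantically_solvable S HC.
Proof.
move=> /syntactically_solvableE[sol _ sol_HC] M SM.
by exists (@sol_rel sol M) => h /sol_HC; apply.
Qed.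

End Solutions.

(** * Expansions and derivations *)

Section Numbered.

Variable T : Type.
Implicit Type s : seq T.

Lemma In_zip_iota s n x : List.In x s -> exists i, List.In (i, x) (zip (iota n (size s)) s).
Proof.
elim: s n => //= y s IH n [->|/(IH n.+1)[i Hi]]; first by exists n; left.
by exists i; right.
Qed.

Lemma In_numbered s x : List.In x s -> exists i, List.In (i, x) (numbered s).
Proof. exact: In_zip_iota. Qed.

Lemma numbered_map (T' : Type) (f : T -> T') s :
  numbered (map f s) = [seq (ix.1, f ix.2) | ix <- numbered s].
Proof.
rewrite /numbered size_map; by elim: s 0 => //= x s IH n; rewrite IH.
Qed.

End Numbered.

(** Positions are written innermost first, so [suffix] means lying below; subtrees of distinct
    siblings are thus disjoint. *)
Lemma suffix_cons_inj (T : eqType) (x y : T) s t :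
  suffix (x :: s) t -> suffix (y :: s) t -> x = y.
Proof.
rewrite !suffixE /= => /eqP E1 /eqP E2.
by have := E1; rewrite E2 => -[].
Qed.

(** * Soundness and completeness of the expansion *)

Section Expansion.

Variables (F P : symbols) (R : eqType) (ar : R -> nat) (HC : seq (clause F P ar)).
Variable M : structure F P.
Implicit Types (h : clause F P ar) (a b : atom F ar) (v w : nat -> dom M).
Implicit Types (rho : rel_interp ar (dom M)) (pi q : seq nat).

Lemma head_terms_variant r h :
  head_terms (variant r h) = map (term_rename r) (head_terms h).
Proof.
rewrite /head_terms /=; case: (head h) => //= H.
by rewrite !codomE -map_comp.
Qed.

Lemma body_holds_rename rho v r h :
  body_holds rho v (constr (variant r h)) (body (variant r h)) <->
  body_holds rho (v \o r) (constr h) (body h).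
Proof.
rewrite /body_holds /= holds_rename; split=> -[Hc Hb]; split=> // b.
  by move=> bh; apply/atom_holds_rename; apply: Hb; apply/In_map_iff; exists b.
by move=> bh; have [b' [b'h <-]] := In_map bh; apply/atom_holds_rename; apply: Hb.
Qed.

Lemma exp_body_sound rho v e pi h :
  (forall pi' b, holds v (e pi' b) -> atom_holds rho v b) ->
  holds v (exp_body e pi h) -> body_holds rho v (constr h) (body h).
Proof.
move=> He [Hc /holds_bigAnd Hb]; split=> // b bh; have [j jb] := In_numbered bh.
exact: He (Hb (j, b) jb).
Qed.

(** By induction on the depth, a true disjunct is a clause variant with true body, and its equations
    identify the head with [a]. *)
Lemma exp_atom_rec_sound rho n pi a v :
  (forall h, List.In h HC -> head h -> clause_holds rho h) ->
  holds v (exp_atom_rec HC n pi a) -> atom_holds rho v a.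
Proof.
move=> rho_HC; elim: n pi a v => //= n IH pi a v.
move=> /holds_bigOr[[i h] /In_filter_iff[/= /eqP hp /In_zip2 /= hHC] [Hb]].
have Hb' := @exp_body_sound rho v _ (i :: pi) (variant _ h) (fun pi' b => IH pi' b v) Hb.
rewrite head_terms_variant => /holds_eqs E.
apply: (clause_holds_head _ hp (proj1 (body_holds_rename _ _ _ _) Hb')).
  by apply: rho_HC => //; have [H ->] := head_relP hp.
rewrite -map_eval_rename; apply: E.
by rewrite size_map (size_head_terms hp) size_codom card_ord.
Qed.

Lemma expansion_sound rho v :
  (forall h, List.In h HC -> clause_holds rho h) -> ~ holds v (expansion HC).
Proof.
move=> rho_HC /holds_bigOr[[i h] /In_filter_iff[/= /eqP hp /In_zip2 /= hHC] Hb].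
have /body_holds_rename[Hc Hl] := @exp_body_sound rho v _ [:: i] (variant _ h)
  (fun pi b => @exp_atom_rec_sound rho _ pi b v (fun h' h'HC _ => rho_HC h' h'HC)) Hb.
have := rho_HC h hHC _ Hc Hl.
by move: hp; rewrite /head_rel /=; case: (head h).
Qed.

(** The least model over [M] of the clauses with atomic head. *)
Inductive derivable : rel_interp ar (dom M) :=
| Derivable h H v : List.In h HC -> head h = Some H -> holds v (constr h) ->
    (forall b, List.In b (body h) -> derivable (fun i => eval v (@args _ _ _ b i))) ->
    derivable (fun i => eval v (@args _ _ _ H i)).

(* A derivation of [p d] yields values [g q x] for the variables [fresh q x] of
   the positions [q] below one disjunct [i] of the expansion at [pi]. *)
Definition expandable p (d : 'I_(ar p) -> dom M) : Prop :=
  forall pi, exists i (g : seq nat -> nat -> dom M), forall v,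
    (forall q x, suffix (i :: pi) q -> v (fresh q x) = g q x) ->
    forall a, rel a = p -> vals v a = codom d -> holds v (exp_atom HC pi a).

Lemma codom_eval w b : codom (fun i => eval w (@args _ _ _ b i)) = vals w b.
Proof. by rewrite /vals !codomE -map_comp. Qed.

(** The atoms of a body use disjoint sets of positions, so their values can be glued. The start
    index [n] is general for the induction. *)
Lemma expandable_seq w (s : seq (atom F ar)) n pi :
  (forall b, List.In b s -> expandable (fun i => eval w (@args _ _ _ b i))) ->
  exists g : seq nat -> nat -> dom M, forall v,
    (forall j q x, n <= j -> suffix (j :: pi) q -> v (fresh q x) = g q x) ->
    forall j b, List.In (j, b) (zip (iota n (size s)) s) ->
    forall a, rel a = rel b -> vals v a = vals w b ->
    holds v (exp_atom HC (j :: pi) a).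
Proof.
elim: s n => [|b s IH] n Hs; first by exists (fun _ _ => w 0).
have [|g Hg] := IH n.+1; first by move=> c cs; apply: Hs; right.
have [i [g' Hg']] := Hs b (or_introl erefl) (n :: pi).
exists (fun q => if suffix (n :: pi) q then g' q else g q) => v Hv j c /= [[<- <-]|jc] a.
  move=> ra va; apply: Hg' => [q x qs||] //; last by rewrite codom_eval.
  have qs' : suffix (n :: pi) q := suffix_trans (suffix_cons _ _) qs.
  by rewrite (Hv n) // qs'.
apply: (Hg v _ j c jc) => j' q x lt qs; rewrite (Hv j') 1?ltnW //.
(* A position below both children [j'] and [n] forces [j' = n], against [n < j']. *)
by case: ifP => // qs'; have := suffix_cons_inj qs qs' => E; rewrite E ltnn in lt.
Qed.

Lemma expandable_body h w pi :
  body_holds (fun p => @expandable p) w (constr h) (body h) ->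
  exists g : seq nat -> nat -> dom M, forall v,
    (forall q x, suffix pi q -> v (fresh q x) = g q x) ->
    v \o fresh pi = w /\
    holds v (exp_body (exp_atom HC) pi (variant (fresh pi) h)).
Proof.
move=> [Hc /(expandable_seq 0 pi)[g Hg]].
(* The clause variables at [pi] itself take their values from [w]; strictly below [pi] the body
   atoms decide. *)
exists (fun q => if q == pi then w else g q) => v Hv.
have vw : v \o fresh pi = w.
  by apply: functional_extensionality => x /=; rewrite Hv ?suffix_refl ?eqxx.
split=> //; split; first by apply/holds_rename; rewrite vw.
rewrite numbered_map -map_comp; apply/holds_bigAnd => -[j b] jb /=.
apply: (Hg v _ j b) => //; last by rewrite vals_rename vw.
move=> j' q x _ qs; have qs' := suffix_trans (suffix_cons _ _) qs; rewrite Hv //.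
by case: eqP => // E; have := size_suffix qs; rewrite E /= ltnn.
Qed.

(** Induction on the derivation: the last clause used selects the disjunct, and recursion freedom
    lets [exp_atomE] unfold the expansion at each node. *)
Lemma derivable_expandable (HC_rf : recursion_free HC) p (d : 'I_(ar p) -> dom M) :
  derivable d -> expandable d.
Proof.
elim=> {p d} h H w hHC hH Hc _ Hb pi; have [i ih] := In_numbered hHC.
have [g Hg] := expandable_body (i :: pi) (conj Hc Hb).
exists i, g => v /Hg[vw Hv] a ra va; rewrite exp_atomE //.
apply/holds_bigOr; exists (i, h).
  by apply/In_filter_iff; rewrite /head_rel hH /= ra.
split=> //; rewrite head_terms_variant.
have szh : head_rel h = Some (rel H) by rewrite /head_rel hH.
apply/holds_eqs.
  by rewrite size_map (size_head_terms szh) size_codom card_ord ra.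
by rewrite map_eval_rename vw -[LHS]/(vals v a) va codom_eval /vals /head_terms hH.
Qed.

Lemma expansion_complete (HC_rf : recursion_free HC) :
  (forall v, ~ holds v (expansion HC)) ->
  forall h, List.In h HC -> clause_holds derivable h.
Proof.
move=> unsat h hHC w Hc Hb; case hH: (head h) => [H|]; first exact: Derivable hHC hH Hc Hb.
have [i ih] := In_numbered hHC.
have [g Hg] := expandable_body [:: i]
  (conj Hc (fun b bh => derivable_expandable HC_rf (Hb b bh))).
(* Decoding a variable gives its position and name; [w 0] is a default for numbers that code no such
   pair. *)
pose v y := if (unpickle y : option (seq nat * nat)) is Some qx then g qx.1 qx.2 else w 0.
have [q x _|_ Hv] := Hg v; first by rewrite /v /fresh pickleK.
apply: (unsat v); apply/holds_bigOr; exists (i, h) => //.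
by apply/In_filter_iff; rewrite /head_rel hH.
Qed.

End Expansion.

Theorem theorem2 (F P : symbols) (S : structure F P -> Prop)
    (C : formula F P -> Prop) (R : eqType) (ar : R -> nat)
    (HC : seq (clause F P ar))
    (C_lang : constraint_language C)
    (C_interp : interpolation_property S C)
    (HC_over_C : clauses_over C HC)
    (HC_rf : recursion_free HC) :
  (semantically_solvable S HC <-> syntactically_solvable S C HC) /\
  (syntactically_solvable S C HC <-> unsatisfiable S (expansion HC)).
Proof.
have sem_syn := semantically_syntactically_solvable C_lang C_interp HC_over_C HC_rf.
have syn_sem := @syntactically_semantically_solvable _ _ S C _ _ HC.
split; split=> // [/syn_sem sem [M [SM [v Hv]]]|unsat].
  by have [rho rho_HC] := sem M SM; apply: expansion_sound rho_HC Hv.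
(* Unsatisfiability makes derivability a model, which is (1), and (2) follows by interpolation. *)
apply: sem_syn => M SM; exists (@derivable _ _ _ _ HC M).
apply: expansion_complete => // v Hv; apply: unsat.
by exists M; split=> //; exists v.
Qed.
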